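(* Let $\varphi\in\Phi$ and let $f\in L^{\varphi}(\Omega)$. Let $\psi^-$ and $\psi^+$ be the left and right derivatives of $\varphi$, respectively. Then a polynomial $P\in\Pi^m$ belongs to $\mu_\varphi(f)$ if and only if, for all $Q\in\Pi^m$, $$\int_{\{f>P\}\cap\{Q>0\}}\psi^-(|f-P|)\,Q\,dx+\int_{\{f>P\}\cap\{Q<0\}}\psi^+(|f-P|)\,Q\,dx\leqslant\int_{\{f<P\}\cap\{Q<0\}}\psi^-(|f-P|)\,Q\,dx+\int_{\{f<P\}\cap\{Q>0\}}\psi^+(|f-P|)\,Q\,dx .$$
   Context: $\Omega$ is a bounded Lebesgue measurable subset of $\mathbb{R}^n$; $\int_A f$ means $\int_{\Omega\cap A}f\,dx$ with Lebesgue measure. $\mathcal S$ is the set of non-decreasing functions $\psi:[0,\infty)\to[0,\infty)$ with $\psi(0)=0$, $\psi(s)>0$ for $s>0$, $\psi(s)\to0$ as $s\to0^+$ and $\psi(s)\to\infty$ as $s\to\infty$. A function $\psi$ satisfies the $\Delta_2$ condition if there is a constant $\Lambda_\psi>0$ with $\psi(2s)\leqslant\Lambda_\psi\psi(s)$ for all $s\ge0$. $\Phi$ is the class of functions $\varphi(s)=\int_0^s\psi(r)\,dr$ on $[0,\infty)$, with $\psi\in\mathcal S$, that satisfy the $\Delta_2$ condition. $\psi^-,\psi^+$ denote the left and right derivatives of $\varphi$, with $\psi^-(0)=0$ by convention (and $\psi^+(0)=0$). $L^\varphi(\Omega)$ is the class of real-valued Lebesgue measurable $f$ on $\Omega$ with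 $\int_\Omega\varphi(|f|)\,dx<\infty$. $\Pi^m$ is the space of real algebraic polynomials on $\mathbb{R}^n$ of degree at most $m$. For $f\in L^\varphi(\Omega)$, $\mu_\varphi(f)$ is the set of all $P\in\Pi^m$ with $\int_\Omega\varphi(|f-P|)\,dx=\inf_{Q\in\Pi^m}\int_\Omega\varphi(|f-Q|)\,dx$. *)

(* Defs.v *)
From HB Require Import structures.
From mathcomp Require Import all_boot all_order all_algebra.
From mathcomp Require Import all_classical all_reals all_analysis.
From mathcomp Require mpoly.
Import (canonicals, coercions) mpoly.
Set Implicit Arguments.
Unset Strict Implicit.
Unset Printing Implicit Defensive.
Import Order.TTheory GRing.Theory Num.Theory.
Import numFieldNormedType.Exports.
Local Open Scope classical_set_scope.
Local Open Scope ring_scope.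

Section cons_measure.
Context (R : realType) (n : nat).
Variable m : {sigma_finite_measure set (n.-tuple R) -> \bar R}.
Local Open Scope ereal_scope.

Definition tuple_cons (x : R * n.-tuple R) : n.+1.-tuple R :=
  [tuple of x.1 :: x.2].

Lemma measurable_tuple_cons : measurable_fun setT tuple_cons.
Proof. exact: measurable_cons. Qed.

Let measurable_tuple_cons_preimage A :
  measurable A -> measurable (tuple_cons @^-1` A).
Proof.
by move=> mA; rewrite -[X in measurable X]setTI; exact: measurable_tuple_cons.
Qed.

Definition cons_measure : set (n.+1.-tuple R) -> \bar R :=
  pushforward (@lebesgue_measure R \x m) tuple_cons.

Let cons_measure0 : cons_measure set0 = 0.
Proof. by rewrite /cons_measure /pushforward preimage_set0 measure0. Qed.

Let cons_measure_ge0 A : 0 <= cons_measure A.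
Proof. by rewrite /cons_measure /pushforward; exact: measure_ge0. Qed.

Let cons_measure_sigma_additive : semi_sigma_additive cons_measure.
Proof.
move=> F mF tF mUF; rewrite /cons_measure /pushforward preimage_bigcup.
apply: measure_semi_sigma_additive.
- by move=> k; exact: measurable_tuple_cons_preimage.
- apply/trivIsetP => /= i j _ _ ij; rewrite -preimage_setI.
  by move/trivIsetP : tF => /(_ _ _ _ _ ij) ->//; rewrite preimage_set0.
- by rewrite -preimage_bigcup; exact: measurable_tuple_cons_preimage.
Qed.

HB.instance Definition _ := isMeasure.Build _ _ _ cons_measure
  cons_measure0 cons_measure_ge0 cons_measure_sigma_additive.

Lemma cons_measure_rect (A : set R) (B : set (n.-tuple R)) :
  measurable A -> measurable B ->
  cons_measure [set t | A (thead t) /\ B [tuple of behead t]] =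
  lebesgue_measure A * m B.
Proof.
move=> mA mB; rewrite /cons_measure /pushforward -product_measure1E//.
congr product_measure1; apply/seteqP.
have bK (x : R) (t : n.-tuple R) : [tuple of behead (x :: t)] = t.
  exact: val_inj.
by split => -[x t] /=; rewrite /tuple_cons/= theadE bK.
Qed.

Let cons_measure_sigma_finite : sigma_finite setT cons_measure.
Proof.
have /sigma_finiteP[F [TF ndF Foo]] := sigma_finiteT (@lebesgue_measure R).
have /sigma_finiteP[G [TG ndG Goo]] := sigma_finiteT m.
exists (fun k => [set t | F k (thead t) /\ G k [tuple of behead t]]) => [|k].
  apply/esym/seteqP; split => // t _.
  have [i _ Fi] : (\bigcup_k F k) (thead t) by rewrite -TF.
  have [j _ Gj] : (\bigcup_k G k) [tuple of behead t] by rewrite -TG.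
  exists (maxn i j) => //; split.
  - by move: Fi; exact/subsetPset/ndF/leq_maxl.
  - by move: Gj; exact/subsetPset/ndG/leq_maxr.
have [mF Fk] := Foo k; have [mG Gk] := Goo k; split.
  apply: measurableI.
  - by rewrite -[X in measurable X]setTI; exact: measurable_tnth.
  - by rewrite -[X in measurable X]setTI; exact: measurable_behead.
rewrite cons_measure_rect// lte_mul_pinfty//.
by rewrite ge0_fin_numE.
Qed.

HB.instance Definition _ := Measure_isSigmaFinite.Build _ _ _ cons_measure
  cons_measure_sigma_finite.

End cons_measure.

(* Product of n copies of the Lebesgue measure of R, on Borel sets. *)
Fixpoint borel_lebesgue (R : realType) (n : nat) :
    {sigma_finite_measure set (n.-tuple R) -> \bar R} :=
  match n with
  | 0%N => \d_([tuple] : 0.-tuple R)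
  | n'.+1 => cons_measure (borel_lebesgue R n')
  end.

(* R^n with its Lebesgue sigma-algebra, obtained as the Caratheodory-measurable
   sets of the outer measure induced by borel_lebesgue. *)
Definition Rn (R : realType) (n : nat) : measurableType _ :=
  caratheodory_type ((borel_lebesgue R n)^*)%mu.

Definition lebesgue_n (R : realType) (n : nat) :
    {measure set (Rn R n) -> \bar R} :=
  @completed_measure_extension _ _ _ (borel_lebesgue R n).

Definition coord (R : realType) (n : nat) (x : Rn R n) (i : 'I_n) : R :=
  tnth (x : n.-tuple R) i.

Lemma lebesgue_n_box (R : realType) (n : nat) (a b : 'I_n -> R) :
  (forall i, a i <= b i) ->
  lebesgue_n R n [set x | forall i, a i <= coord x i <= b i] =
  (\prod_(i < n) (b i - a i))%:E.
Proof.
move=> ab; rewrite /lebesgue_n /=/completed_measure_extension /coord.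
suff [mB BE] :
    measurable ([set x | forall i, a i <= tnth x i <= b i] : set (n.-tuple R)) /\
    borel_lebesgue R n [set x | forall i, a i <= tnth x i <= b i] =
      (\prod_(i < n) (b i - a i))%:E by rewrite measurable_mu_extE.
have tnth_behead k (t : k.+1.-tuple R) i :
    tnth t (lift ord0 i) = tnth [tuple of behead t] i.
  by rewrite [in LHS](tuple_eta t) tnthS.
elim: n a b ab => [|n ih] a b ab.
  rewrite (_ : [set _ | _] = setT); last by apply/seteqP; split => // x _ [].
  by split; [exact: measurableT|rewrite big_ord0 /= diracE in_setT].
have [mB BE] := ih (a \o lift ord0) (b \o lift ord0) (fun i => ab _).
have mA : measurable (`[a ord0, b ord0]%classic : set R) by exact: measurable_itv.
have -> : [set x : n.+1.-tuple R | forall i, a i <= tnth x i <= b i] =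
    [set t | `[a ord0, b ord0]%classic (thead t) /\
      [set x | forall i, (a \o lift ord0) i <= tnth x i <= (b \o lift ord0) i]
        [tuple of behead t]].
  apply/seteqP; split => t /=.
    move=> h; split; first by rewrite in_itv/=; exact: h.
    by move=> i; have := h (lift ord0 i); rewrite tnth_behead.
  rewrite in_itv/= => -[h0 h1] i; case: (unliftP ord0 i) => [j ->|->//].
  by rewrite tnth_behead; exact: h1.
split.
  move: mA; set A := (X in measurable X) => mA; apply: measurableI.
  - by rewrite -[X in measurable X]setTI; exact: measurable_tnth.
  - by rewrite -[X in measurable X]setTI; exact: measurable_behead.
rewrite [LHS](cons_measure_rect _ mA mB) BE lebesgue_measure_itv/= lte_fin big_ord_recl.
case: ifPn => [_|]; first by rewrite -EFinD -EFinM.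
rewrite -leNgt => ba; have -> : b ord0 = a ord0 by apply/le_anti; rewrite ba ab.
by rewrite mul0e subrr mul0r.
Qed.

Section problem.
Context (R : realType).

(* Only the values on [0, +oo[ matter; there psi >= 0 is a consequence of
   psi 0 = 0 and positivity on ]0, +oo[. *)
Definition class_S (psi : R -> R) : Prop :=
  [/\ (forall s t, 0 <= s -> s <= t -> psi s <= psi t),
      psi 0 = 0,
      (forall s, 0 < s -> 0 < psi s),
      psi s @[s --> 0^'+] --> 0 &
      psi s @[s --> +oo] --> +oo].

Definition Delta2 (psi : R -> R) : Prop :=
  exists2 Lambda : R, 0 < Lambda &
    forall s, 0 <= s -> psi (2 * s) <= Lambda * psi s.

Definition class_Phi (phi : R -> R) : Prop :=
  (exists2 psi, class_S psi &
    forall s, 0 <= s ->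
      phi s = \int[lebesgue_measure]_(r in `[0, s]) psi r) /\
  Delta2 phi.

(* phi is only meaningful on [0, +oo[, so its left derivative at 0 is set
   to 0. *)
Definition psi_minus (phi : R -> R) (s : R) : R :=
  if 0 < s then lim ((phi (s + h) - phi s) / h @[h --> 0^'-]) else 0.

Definition psi_plus (phi : R -> R) (s : R) : R :=
  lim ((phi (s + h) - phi s) / h @[h --> 0^'+]).

Context (n : nat).

Definition bounded_Rn (A : set (Rn R n)) : Prop :=
  exists M : R, forall x, A x -> forall i, `|coord x i| <= M.

Definition peval (P : mpoly.mpoly n R) (x : Rn R n) : R :=
  mpoly.meval (coord x) P.

(* msize is the total degree plus one, and 0 for the zero polynomial. *)
Definition Pi (m : nat) : set (mpoly.mpoly n R) :=
  [set P : mpoly.mpoly n R | (mpoly.msize P <= m.+1)%N].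

Local Open Scope ereal_scope.

Definition modular (Omega : set (Rn R n)) (phi : R -> R) (g : Rn R n -> R) :
    \bar R :=
  \int[lebesgue_n R n]_(x in Omega) (phi `|g x|%R)%:E.

Definition Lphi (Omega : set (Rn R n)) (phi : R -> R) : set (Rn R n -> R) :=
  [set f | measurable_fun Omega f /\ modular Omega phi f < +oo].

Definition mu_phi (Omega : set (Rn R n)) (phi : R -> R) (m : nat)
    (f : Rn R n -> R) : set (mpoly.mpoly n R) :=
  [set P | Pi m P /\
    modular Omega phi (fun x => f x - peval P x)%R =
    ereal_inf [set modular Omega phi (fun x => f x - peval Q x)%R
              | Q in Pi m]].

End problem.

(* Main.v *)
Require Import Defs.
From mathcomp Require Import all_boot all_order all_algebra.
From mathcomp Require Import all_classical all_reals all_analysis.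
From mathcomp Require Import measurable_realfun ring lra.
From mathcomp Require mpoly.
Import (canonicals, coercions) mpoly.
Set Implicit Arguments.
Unset Strict Implicit.
Unset Printing Implicit Defensive.
Import Order.TTheory GRing.Theory Num.Theory.
Import numFieldNormedType.Exports.
Local Open Scope classical_set_scope.
Local Open Scope ring_scope.

(* The even function E x = phi |x| is convex, so for a = f - P and q = Q the
   difference quotients (E (a - t q) - E a) / t are nondecreasing in t > 0 and
   decrease, as t -> 0+, to a one-sided derivative D(a, q) <= E (a - q) - E a.
   Expressing D through psi^- and psi^+ according to the signs of a and q (it
   vanishes when a = 0 because psi is continuous at 0), the condition of the
   theorem reads: the integral of D(f - P, Q) is nonnegative for every Q.
   It suffices for minimality by integrating D(a, q) <= E (a - q) - E a, and it
   is necessary by dominated convergence, the quotients with 0 < t <= 1 being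
   bounded by E (a - q) + E (a + q).  The Delta_2 condition and the boundedness
   of Omega make all the functions E (f - Q) integrable. *)

(** * Primitives of nondecreasing functions *)

Section primitive.
Context (R : realType) (psi phi : R -> R).
Hypothesis psi_nd : forall s t : R, 0 <= s -> s <= t -> psi s <= psi t.
Hypothesis psi0 : psi 0 = 0.
Hypothesis phiE : forall s : R, 0 <= s ->
  phi s = \int[lebesgue_measure]_(r in `[0, s]) psi r.

Lemma integrable_nondecreasing (s : R) : 0 <= s ->
  lebesgue_measure.-integrable `[0, s] (EFin \o psi).
Proof.
move=> s0; apply: measurable_bounded_integrable => //.
- by rewrite /= lebesgue_measure_itv/=; case: ifPn => // _; rewrite ltry.
(* [psi] is monotone only on [[0, +oo[]; composing with [Num.max r 0] makes it monotone on the whole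
   line without changing it on [[0, s]]. *)
- refine (eq_measurable_fun (fun r : R => psi (Num.max r 0)) _ _).
    by move=> r; rewrite inE/= in_itv/= => /andP[r0 _]; rewrite max_l.
  apply: nondecreasing_measurable => // x y xy.
  by apply: psi_nd; [rewrite le_max lexx orbT|rewrite ge_max !le_max xy lexx orbT].
- exists (psi s); split; first exact: num_real.
  move=> M sM r; rewrite /= in_itv/= => /andP[r0 rs].
  rewrite ger0_norm; first exact: le_trans (psi_nd _ _) (ltW sM).
  by rewrite -psi0; exact: psi_nd.
Qed.

(** The increment of [phi] is the integral of [psi] over []s, u]], where monotonicity keeps [psi]
    between [psi s] and [psi u]. *)
Lemma primitive_bounds (s u : R) : 0 <= s -> s <= u ->
  psi s * (u - s) <= phi u - phi s <= psi u * (u - s).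
Proof.
move=> s0 su; have u0 := le_trans s0 su.
rewrite !phiE// Rintegral_itvB//; last exact: integrable_nondecreasing.
have mE : lebesgue_measure `]s, u] = (u - s)%:E.
  rewrite lebesgue_measure_itv/= lte_fin; case: ltP => // us.
  by have -> : u = s by [apply/le_anti; rewrite us su]; rewrite subrr.
have cE c : \int[lebesgue_measure]_(r in `]s, u]) c = c * (u - s).
  by rewrite Rintegral_cst//= mE.
have ip : lebesgue_measure.-integrable `]s, u] (EFin \o psi).
  apply: integrableS (integrable_nondecreasing u0) => //.
  by move=> r; rewrite /= !in_itv/= => /andP[/ltW sr ->]; rewrite (le_trans s0).
have ic c : lebesgue_measure.-integrable `]s, u] (EFin \o cst c).
  apply: measurable_bounded_integrable => //; first by rewrite /= mE ltry.
  by exists `|c|; split; [exact: num_real|move=> M + r _; exact: ltW].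
apply/andP; split; rewrite -cE; apply: le_Rintegral => //.
- by apply: ic.
- by move=> r; rewrite /= in_itv/= => /andP[/ltW sr _]; exact: psi_nd.
- by apply: ic.
- move=> r; rewrite /= in_itv/= => /andP[/ltW sr ru]; apply: psi_nd => //.
  exact: le_trans sr.
Qed.

Lemma primitive_nd (s u : R) : 0 <= s -> s <= u -> phi s <= phi u.
Proof.
move=> s0 su; have /andP[+ _] := primitive_bounds s0 su.
have : 0 <= psi s by rewrite -psi0; exact: psi_nd.
by move=> p0 h; rewrite -subr_ge0 (le_trans _ h)// mulr_ge0// subr_ge0.
Qed.

Lemma primitive0 : phi 0 = 0.
Proof. by rewrite phiE// set_itv1 Rintegral_set1. Qed.

Lemma primitive_ge0 (s : R) : 0 <= s -> 0 <= phi s.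
Proof. by rewrite -{2}primitive0; exact: primitive_nd. Qed.

(** Supporting lines of the even function [phi |x|]: the bounds above give the slope [psi |x|] in
    the variable [|y|], whichever of [|x|] and [|y|] is larger, and [sg x * y <= |y|] passes from
    [|y|] to [y]. *)
Lemma primitive_subgradient (x y : R) :
  phi `|x| + Num.sg x * psi `|x| * (y - x) <= phi `|y|.
Proof.
have p0 : 0 <= psi `|x| by rewrite -psi0; exact: psi_nd.
have h : psi `|x| * (`|y| - `|x|) <= phi `|y| - phi `|x|.
  have [xy|/ltW yx] := leP `|x| `|y|.
    by have /andP[] := primitive_bounds (normr_ge0 x) xy.
  by have /andP[_] := primitive_bounds (normr_ge0 y) yx; lra.
suff : Num.sg x * psi `|x| * (y - x) <= psi `|x| * (`|y| - `|x|) by lra.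
have -> : Num.sg x * psi `|x| * (y - x) = psi `|x| * (Num.sg x * y - `|x|).
  by rewrite (normrEsg x); ring.
rewrite ler_wpM2l// lerB//.
apply: le_trans (ler_norm _) _; rewrite normrM.
by rewrite -[leRHS]mul1r ler_wpM2r// normr_sg; case: (x != 0).
Qed.

End primitive.

(** * One-sided directional derivatives of convex functions *)

Definition dquot (R : realType) (E : R -> R) (a q t : R) : R :=
  (E (a - t * q) - E a) / t.

(** The direction is [- q] because replacing [P] by [P + t Q] moves [f - P] to [f - P - t Q]. *)
Definition dirder (R : realType) (E : R -> R) (a q : R) : R :=
  lim (dquot E a q t @[t --> 0^'+]).

Section convex.
Context (R : realType) (E g : R -> R).
(** A supporting line at every point is equivalent to convexity of [E]. *)
Hypothesis subgradient : forall x y : R, E x + g x * (y - x) <= E y.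

(** The supporting line at the intermediate point [a - t * q] is compared with [E] at [a] and at
    [a - u * q]; with weights [u - t] and [t] the slope terms cancel. *)
Lemma dquot_nd a q t u : 0 < t -> t <= u -> dquot E a q t <= dquot E a q u.
Proof.
move=> t0 tu; have u0 := lt_le_trans t0 tu.
rewrite /dquot ler_pdivrMr// mulrAC ler_pdivlMr//.
have h1 := subgradient (a - t * q) a.
have h2 := subgradient (a - t * q) (a - u * q).
have := ler_wpM2l (ltW t0) h2.
have ut : 0 <= u - t by rewrite subr_ge0.
have := ler_wpM2l ut h1.
lra.
Qed.

Lemma dquot_ge a q t : 0 < t -> - (g a * q) <= dquot E a q t.
Proof.
move=> t0; rewrite /dquot ler_pdivlMr//.
by have := subgradient a (a - t * q); lra.
Qed.

(** The quotients decrease as [t] decreases to 0 and are bounded below by [dquot_ge], so [dirder] is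
    a genuine limit. *)
Lemma dquot_cvg a q : dquot E a q t @[t --> 0^'+] --> dirder E a q.
Proof.
apply: nondecreasing_at_right_is_cvgr.
- near=> x => s t; rewrite !in_itv/= => /andP[s0 _] _ st.
  exact: dquot_nd.
- near=> x; exists (- (g a * q)) => _ [t /=] /[!in_itv]/= /andP[t0 _] <-.
  exact: dquot_ge.
Unshelve. all: by end_near. Qed.

(** Sequential form, for use in dominated convergence. *)
Lemma dquot_cvgn a q :
  dquot E a q k.+1%:R^-1 @[k --> \oo] --> dirder E a q.
Proof.
have /cvg_at_rightP := @dquot_cvg a q; apply; split => [k|].
  by rewrite invr_gt0.
exact: cvg_harmonic.
Qed.

(** As [t] decreases to 0, the monotone quotients stay below their value at [t = 1]. *)
Lemma dirder_le a q : dirder E a q <= E (a - q) - E a.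
Proof.
have -> : E (a - q) - E a = dquot E a q 1 by rewrite /dquot mul1r divr1.
apply: limr_le; first by apply/cvg_ex; exists (dirder E a q); exact: dquot_cvg.
near=> t; apply: dquot_nd => //; near: t; exact: nbhs_right_le.
Unshelve. all: by end_near. Qed.

(** A majorant independent of [t]. Above, the quotient is at most its value at [t = 1]; below,
    [- (g a * q)] is at least [E a - E (a + q)]. *)
Lemma dquot_norm_le a q t : (forall x, 0 <= E x) -> 0 < t -> t <= 1 ->
  `|dquot E a q t| <= E (a - q) + E (a + q).
Proof.
move=> E0 t0 t1.
have h := dquot_nd a q t0 t1; rewrite {2}/dquot mul1r divr1 in h.
have h1 := dquot_ge a q t0; have := subgradient a (a + q).
have := E0 a; have := E0 (a - q); have := E0 (a + q).
by move=> *; rewrite ler_norml; apply/andP; split; lra.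
Qed.

(** Substituting [c * t] for [t]; this reduces every nonzero direction to [q = 1] or [q = -1]. *)
Lemma dirderZ a q c : 0 < c -> dirder E a (c * q) = c * dirder E a q.
Proof.
move=> c0; apply/cvg_lim => //.
have -> : dquot E a (c * q) = (fun t => c * dquot E a q (c * t)).
  apply/funext => t; rewrite /dquot mulrA (mulrC t) invfM mulrCA mulVKf//.
  by rewrite gt_eqF.
apply: cvgM; first exact: cvg_cst.
apply/cvg_at_rightP => u [u0 ucvg].
have /cvg_at_rightP := @dquot_cvg a q; apply; split => [k|].
  exact: mulr_gt0.
by rewrite -(mulr0 c); apply: cvgM => //; exact: cvg_cst.
Qed.

Lemma dirder0r a : dirder E a 0 = 0.
Proof.
apply/cvg_lim => //; rewrite (_ : dquot E a 0 = cst 0); first exact: cvg_cst.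
by apply/funext => t; rewrite /dquot mulr0 subr0 subrr mul0r.
Qed.

End convex.

Arguments dquot_cvg {R E g}.
Arguments dquot_cvgn {R E g}.

(** * Directional derivatives of [phi |x|] in terms of the one-sided derivatives of [phi] *)

Section even.
Context (R : realType) (psi phi : R -> R).
Hypothesis psi_nd : forall s t : R, 0 <= s -> s <= t -> psi s <= psi t.
Hypothesis psi0 : psi 0 = 0.
Hypothesis psi_cvg0 : psi s @[s --> 0^'+] --> 0.
Hypothesis phiE : forall s : R, 0 <= s ->
  phi s = \int[lebesgue_measure]_(r in `[0, s]) psi r.

Let E (x : R) := phi `|x|.
Let subgradient := primitive_subgradient psi_nd psi0 phiE.

Lemma dirderN a q : dirder E (- a) (- q) = dirder E a q.
Proof.
rewrite /dirder (_ : dquot E (- a) (- q) = dquot E a q)//; apply/funext => t.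
by rewrite /dquot /E mulrN -opprD !normrN.
Qed.

Lemma dirder_psi_plus (s : R) : 0 < s -> dirder E s (-1) = psi_plus phi s.
Proof.
move=> s0; apply/esym/cvg_lim => //.
apply: cvg_trans (dquot_cvg subgradient s (-1)); apply: near_eq_cvg.
near=> h; have h0 : 0 < h by [].
by rewrite /dquot mulrN1 opprK !gtr0_norm// addr_gt0.
Unshelve. all: by end_near. Qed.

(** The direction [1] moves [s] to [s - t]; the substitution [h = - t] turns the quotient into the
    left difference quotient, up to sign. *)
Lemma dirder_psi_minus (s : R) : 0 < s -> dirder E s 1 = - psi_minus phi s.
Proof.
move=> s0; rewrite /psi_minus s0; apply: oppr_inj; rewrite opprK.
apply/esym/cvg_lim => //; apply/cvg_at_leftNP; rewrite oppr0.
apply: cvg_trans (cvgN (dquot_cvg subgradient s 1)); apply: near_eq_cvg.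
near=> h; have h0 : 0 < h by [].
(* This keeps [s - h] positive, so that its absolute value disappears. *)
have hs : h < s by near: h; exact: nbhs_right_lt.
by rewrite fctE /dquot /= mulr1 !gtr0_norm ?subr_gt0// invrN mulrN.
Unshelve. all: by end_near. Qed.

(** At 0 the quotient is [phi (t |q|) / t], squeezed between 0 and [psi (|q| t) |q|], which tends to
    0. Hence the set [f = P] will contribute nothing. *)
Lemma dirder0l q : dirder E 0 q = 0.
Proof.
have [->|q0] := eqVneq q 0; first exact: dirder0r.
apply/cvg_lim => //.
have h : psi (`|q| * t) * `|q| @[t --> 0^'+] --> 0.
  rewrite -[X in _ --> X](mul0r `|q|); apply: cvgM; last exact: cvg_cst.
  apply/cvg_at_rightP => u [u0 ucvg].
  move/cvg_at_rightP : psi_cvg0; apply; split => [k|].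
    by rewrite mulr_gt0// normr_gt0.
  by rewrite -(mulr0 `|q|); apply: cvgM => //; exact: cvg_cst.
apply: (@squeeze_cvgr _ _ _ _ (cst 0) _ _ _ 0 _ h); last exact: cvg_cst.
near=> t; have t0 : 0 < t by [].
rewrite /dquot /E /= sub0r normr0 (primitive0 phiE) subr0 normrN normrM gtr0_norm//.
have tq0 : 0 <= t * `|q| by rewrite mulr_ge0// ltW.
rewrite divr_ge0 ?(ltW t0)//= ?(primitive_ge0 psi_nd psi0 phiE)//.
rewrite ler_pdivrMr//.
have /andP[_] := primitive_bounds psi_nd psi0 phiE (lexx 0) tq0.
by rewrite (primitive0 phiE) !subr0 mulrAC (mulrC t) -mulrA (mulrC t).
Unshelve. all: by end_near. Qed.

(** This and the next three formulas yield the four integrands of the theorem: scaling treats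
    [a > 0], and evenness carries the result to [a < 0] with the opposite sign. *)
Lemma dirder_pos_pos a q : 0 < a -> 0 < q ->
  dirder E a q = - (psi_minus phi `|a| * q).
Proof.
move=> a0 q0; rewrite -{1}(mulr1 q) (dirderZ subgradient)// dirder_psi_minus//.
by rewrite gtr0_norm// mulrN mulrC.
Qed.

Lemma dirder_pos_neg a q : 0 < a -> q < 0 ->
  dirder E a q = - (psi_plus phi `|a| * q).
Proof.
move=> a0 q0; rewrite -{1}(opprK q) -mulrN1 (dirderZ subgradient) ?oppr_gt0//.
by rewrite dirder_psi_plus// gtr0_norm// mulNr mulrC.
Qed.

Lemma dirder_neg_neg a q : a < 0 -> q < 0 ->
  dirder E a q = psi_minus phi `|a| * q.
Proof.
move=> a0 q0; rewrite -dirderN dirder_pos_pos ?oppr_gt0//.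
by rewrite normrN mulrN opprK.
Qed.

Lemma dirder_neg_pos a q : a < 0 -> 0 < q ->
  dirder E a q = psi_plus phi `|a| * q.
Proof.
move=> a0 q0; rewrite -dirderN dirder_pos_neg ?oppr_gt0 ?oppr_lt0//.
by rewrite normrN mulrN opprK.
Qed.

End even.

(** * Splitting an integral according to a sign *)

Section sign_split.
Context d (T : measurableType d) (R : realType).
Variable mu : {measure set T -> \bar R}.
Local Open Scope ereal_scope.

Lemma measurable_lt0 (D : set T) (h : T -> R) :
  measurable D -> measurable_fun D h ->
  measurable (D `&` [set x | (h x < 0)%R]).
Proof.
move=> mD mh; have := mh mD `]-oo, 0%R[%classic (measurable_itv _).
by congr measurable.
Qed.

Lemma measurable_gt0 (D : set T) (h : T -> R) :
  measurable D -> measurable_fun D h ->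
  measurable (D `&` [set x | (0 < h x)%R]).
Proof.
move=> mD mh; have := mh mD `]0%R, +oo[%classic (measurable_itv _).
congr (measurable (_ `&` _)); apply/seteqP.
by split=> x /=; rewrite in_itv/= andbT.
Qed.

Lemma integral_sign_split (D : set T) (h : T -> R) (f : T -> \bar R) :
  measurable D -> measurable_fun D h -> measurable_fun D f ->
  (forall x, D x -> h x = 0%R -> f x = 0) ->
  \int[mu]_(x in D) f x =
    \int[mu]_(x in D `&` [set x | (0 < h x)%R]) f x +
    \int[mu]_(x in D `&` [set x | (h x < 0)%R]) f x.
Proof.
move=> mD mh mf f0.
have mp := measurable_gt0 mD mh; have mn := measurable_lt0 mD mh.
rewrite -integral_setU//; last 2 first.
- by apply: measurable_funS mf => // x [[]|[]].
- apply/disj_setPS => x [[_ /= h0] [_ /= h1]].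
  by have := lt_trans h0 h1; rewrite ltxx.
rewrite [LHS]integral_mkcond [RHS]integral_mkcond; congr integral.
apply/funext => x; rewrite !patchE !in_setU !in_setI.
case: (boolP (x \in D)) => [xD|_] /=; last by [].
have [h0|h0|h0] := ltgtP (h x) 0%R.
- by rewrite [X in _ || X](_ : _ = true) ?orbT//; exact/mem_set.
- by rewrite [X in X || _](_ : _ = true)//; exact/mem_set.
- by rewrite f0// ?if_same//; exact/set_mem.
Qed.

End sign_split.

(** * Differentiation under the integral sign *)

Section gateaux.
Context d (T : measurableType d) (R : realType).
Variable mu : {measure set T -> \bar R}.
Context (psi phi : R -> R).
Hypothesis psi_nd : forall s t : R, 0 <= s -> s <= t -> psi s <= psi t.
Hypothesis psi0 : psi 0 = 0.
Hypothesis psi_cvg0 : psi s @[s --> 0^'+] --> 0.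
Hypothesis phiE : forall s : R, 0 <= s ->
  phi s = \int[lebesgue_measure]_(r in `[0, s]) psi r.

Let E (x : R) := phi `|x|.
Let subgradient := primitive_subgradient psi_nd psi0 phiE.

(** Monotonicity gives measurability, after truncating the argument at 0 because [phi] is controlled
    only on [[0, +oo[]. *)
Lemma measurable_primitive_norm : measurable_fun setT E.
Proof.
apply: (eq_measurable_fun ((fun r => phi (Num.max r 0)) \o (fun x : R => `|x|))).
  by move=> r _ /=; rewrite max_l.
apply: measurableT_comp; last exact: normr_measurable.
apply: nondecreasing_measurable => // x y xy.
apply: (primitive_nd psi_nd psi0 phiE); first by rewrite le_max lexx orbT.
by rewrite ge_max !le_max xy lexx orbT.
Qed.

Context (D : set T) (mD : measurable D) (a q : T -> R).
Hypothesis ma : measurable_fun D a.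
Hypothesis mq : measurable_fun D q.

Local Open Scope ereal_scope.

Hypothesis iB : mu.-integrable D (fun x => (E (a x - q x))%:E).
Hypothesis iD : mu.-integrable D (fun x => (E (a x + q x))%:E).

Let dd x := dirder E (a x) (q x).

(** Dominated convergence along [t = 1 / (k + 1)], with the majorant of [dquot_norm_le], gives
    integrability and the limit together. *)
Let dominated :
  mu.-integrable D (EFin \o dd) /\
  \int[mu]_(x in D) (dquot E (a x) (q x) k.+1%:R^-1)%:E @[k --> \oo] -->
    \int[mu]_(x in D) (dd x)%:E.
Proof.
have mdquot k : measurable_fun D (fun x => dquot E (a x) (q x) k.+1%:R^-1).
  apply: measurable_funM; last exact: measurable_cst.
  apply: measurable_funB; apply: measurableT_comp measurable_primitive_norm _ => //.
  by apply: measurable_funB => //; exact: measurable_funM.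
have cdquot x : dquot E (a x) (q x) k.+1%:R^-1 @[k --> \oo] --> dd x.
  exact: (dquot_cvgn subgradient).
have := @dominated_convergence _ _ _ mu D mD
  (fun k x => (dquot E (a x) (q x) k.+1%:R^-1)%:E) (EFin \o dd)
  (fun x => (E (a x - q x))%:E + (E (a x + q x))%:E).
case.
- by move=> k; exact/measurable_EFinP.
- by apply/measurable_EFinP; exact: measurable_fun_cvg mdquot (fun x _ => cdquot x).
- by apply/aeW => x _; apply: cvg_EFin; [exact: nearW|exact: cdquot].
- exact: integrableD.
- apply/aeW => x k _ /=; rewrite lee_fin; apply: (dquot_norm_le subgradient).
  + by move=> y; exact: (primitive_ge0 psi_nd psi0 phiE).
  + by rewrite invr_gt0.
  + by rewrite invf_le1// ler1n.
- by [].
Qed.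

Lemma integrable_dirder : mu.-integrable D (EFin \o dd).
Proof. by case: dominated. Qed.

Lemma integral_dquot_cvg :
  \int[mu]_(x in D) (dquot E (a x) (q x) k.+1%:R^-1)%:E @[k --> \oo] -->
    \int[mu]_(x in D) (dd x)%:E.
Proof. by case: dominated. Qed.

(** The integral is split by the sign of [a], then by that of [q]; the zero sets drop out. The two
    pieces with [a > 0] carry a minus sign and become the left-hand side. *)
Lemma integral_dirder_ge0 :
  (0 <= \int[mu]_(x in D) (dd x)%:E) =
  (\int[mu]_(x in D `&` [set x | (0 < a x)%R] `&` [set x | (0 < q x)%R])
     (psi_minus phi `|a x| * q x)%:E +
   \int[mu]_(x in D `&` [set x | (0 < a x)%R] `&` [set x | (q x < 0)%R])
     (psi_plus phi `|a x| * q x)%:E <=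
   \int[mu]_(x in D `&` [set x | (a x < 0)%R] `&` [set x | (q x < 0)%R])
     (psi_minus phi `|a x| * q x)%:E +
   \int[mu]_(x in D `&` [set x | (a x < 0)%R] `&` [set x | (0 < q x)%R])
     (psi_plus phi `|a x| * q x)%:E).
Proof.
have idd := integrable_dirder.
have mp := measurable_gt0 mD ma; have mn := measurable_lt0 mD ma.
have mdd : measurable_fun D (EFin \o dd) := measurable_int _ idd.
rewrite (integral_sign_split _ mD ma)//; last first.
  by move=> x _ a0; rewrite /dd a0 (dirder0l psi_nd psi0 psi_cvg0 phiE).
have q0 x : q x = 0%R -> (dd x)%:E = 0 by move=> q0; rewrite /dd q0 dirder0r.
have sp : D `&` [set x | (0 < a x)%R] `<=` D by move=> x [].
have sn : D `&` [set x | (a x < 0)%R] `<=` D by move=> x [].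
have mqp := measurable_funS mD sp mq; have mqn := measurable_funS mD sn mq.
rewrite (integral_sign_split _ mp mqp); last 2 first.
- exact: measurable_funS mdd.
- by move=> x _; exact: q0.
rewrite (integral_sign_split _ mn mqn); last 2 first.
- exact: measurable_funS mdd.
- by move=> x _; exact: q0.
have sub A B : D `&` A `&` B `<=` D by move=> x [[]].
have fin A : A `<=` D -> measurable A ->
    \int[mu]_(x in A) (dd x)%:E \is a fin_num.
  by move=> AD mA; apply: integrable_fin_num => //; exact: integrableS idd.
have negE A (F : T -> R) : A `<=` D -> measurable A ->
    (forall x, A x -> dd x = - F x)%R ->
    \int[mu]_(x in A) (F x)%:E = - \int[mu]_(x in A) (dd x)%:E.
  move=> AD mA dF; rewrite -integralN//; last first.
    by apply: integrable_add_def => //; exact: integrableS idd.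
  by apply: eq_integral => x /set_mem Ax; rewrite dF// EFinN oppeK.
rewrite [X in _ = (X + _ <= _)]negE; last 3 first.
- exact: sub.
- exact: measurable_gt0.
- by move=> x [[_ a0] q1]; exact: (dirder_pos_pos psi_nd psi0 phiE).
rewrite [X in _ = (_ + X <= _)]negE; last 3 first.
- exact: sub.
- exact: measurable_lt0.
- by move=> x [[_ a0] q1]; exact: (dirder_pos_neg psi_nd psi0 phiE).
rewrite (_ : \int[mu]_(x in _) (psi_minus phi `|a x| * q x)%:E =
    \int[mu]_(x in D `&` [set x | (a x < 0)%R] `&` [set x | (q x < 0)%R])
      (dd x)%:E); last first.
  apply: eq_integral => x /set_mem[[_ a0] q1].
  by rewrite /dd (dirder_neg_neg psi_nd psi0 phiE).
rewrite (_ : \int[mu]_(x in _) (psi_plus phi `|a x| * q x)%:E =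
    \int[mu]_(x in D `&` [set x | (a x < 0)%R] `&` [set x | (0 < q x)%R])
      (dd x)%:E); last first.
  apply: eq_integral => x /set_mem[[_ a0] q1].
  by rewrite /dd (dirder_neg_pos psi_nd psi0 phiE).
have := fin _ (@sub _ _) (measurable_gt0 mp mqp).
have := fin _ (@sub _ _) (measurable_lt0 mp mqp).
have := fin _ (@sub _ _) (measurable_gt0 mn mqn).
have := fin _ (@sub _ _) (measurable_lt0 mn mqn).
(* All four integrals are finite, so they become real numbers and the comparison is linear. *)
do 4 ![case: (integral _ _ _) => // ?].
by move=> _ _ _ _; rewrite !lee_fin; apply/idP/idP; lra.
Qed.

End gateaux.

(** * Polynomials on a bounded set and integrability of [phi |f - Q|] *)

Section polynomials.
Context (R : realType) (n : nat).
Implicit Types (P Q : mpoly.mpoly n R) (Omega : set (Rn R n)).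

(** Coordinates are Borel, and Borel sets are Caratheodory measurable. *)
Lemma measurable_coord (i : 'I_n) :
  measurable_fun setT (fun x : Rn R n => Defs.coord x i).
Proof.
move=> _ B mB; apply: sub_caratheodory; apply: sub_sigma_algebra.
exact: (@measurable_tnth _ R n i).
Qed.

Lemma measurable_peval P : measurable_fun setT (peval P).
Proof.
rewrite (_ : peval P = (fun x => \sum_(k <- mpoly.msupp P)
    mpoly.mcoeff k P * \prod_i Defs.coord x i ^+ k i)); last first.
  by apply/funext => x; rewrite /peval mpoly.mevalE.
apply: measurable_sum => k; apply: measurable_funM => //.
apply: measurable_prod => i _; apply: measurable_funX.
exact: measurable_coord.
Qed.

Lemma peval_bounded Omega P : bounded_Rn Omega ->
  exists C, forall x, Omega x -> `|peval P x| <= C.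
Proof.
move=> [M OM].
exists (\sum_(k <- mpoly.msupp P) `|mpoly.mcoeff k P| * \prod_i M ^+ k i).
move=> x Ox; rewrite /peval mpoly.mevalE.
apply: le_trans (ler_norm_sum _ _ _) _; apply: ler_sum => k _.
rewrite normrM ler_wpM2l// normr_prod; apply: ler_prod => i _.
by rewrite normr_ge0 normrX lerXn2r ?nnegrE ?(le_trans _ (OM x Ox i)) ?OM.
Qed.

Lemma lebesgue_n_bounded_lty Omega : measurable Omega -> bounded_Rn Omega ->
  (lebesgue_n R n Omega < +oo)%E.
Proof.
move=> mO [M OM].
(* The absolute value keeps the sides nonnegative: [M] itself may be negative when [Omega] is empty
   or [n = 0]. *)
pose box := [set x : Rn R n | forall i, - `|M| <= Defs.coord x i <= `|M|].
have mbox : measurable box.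
  rewrite (_ : box = \bigcap_(i in [set: 'I_n])
      ((fun x => Defs.coord x i) @^-1` `[- `|M|, `|M|])); last first.
    apply/seteqP; split=> x /=.
      by move=> h i _ /=; rewrite in_itv/=; exact: h.
    by move=> h i; have := h i I; rewrite /= in_itv.
  apply: fin_bigcap_measurable => // i _.
  by rewrite -[X in measurable X]setTI; apply: measurable_coord.
have MM : - `|M| <= `|M| by rewrite lerNl (le_trans _ (normr_ge0 M))// oppr_le0.
apply: (@le_lt_trans _ _ (lebesgue_n R n box)).
  apply: le_measure; rewrite ?inE// => x Ox i.
  by rewrite -ler_norml (le_trans (OM x Ox i))// ler_norm.
by rewrite /box (lebesgue_n_box (fun=> MM)) ltry.
Qed.

Lemma PiD m P Q : Pi m P -> Pi m Q -> Pi m (P + Q).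
Proof.
by move=> hP hQ; apply: leq_trans (mpoly.msizeD_le P Q) _; rewrite geq_max hP hQ.
Qed.

Lemma PiZ m (c : R) P : Pi m P -> Pi m (c *: P).
Proof. by move=> hP; apply: leq_trans (mpoly.msizeZ_le P c) _. Qed.

Lemma pevalD P Q x : peval (P + Q) x = peval P x + peval Q x.
Proof. exact: mpoly.mevalD. Qed.

Lemma pevalZ (c : R) P x : peval (c *: P) x = c * peval P x.
Proof. exact: mpoly.mevalZ. Qed.

End polynomials.

(** A quasi-triangle inequality: [|x + y|] is at most twice the larger of [|x|] and [|y|], and
    doubling costs the factor [L]. *)
Lemma Delta2_norm_add (R : realType) (phi : R -> R) :
  (forall s u : R, 0 <= s -> s <= u -> phi s <= phi u) -> phi 0 = 0 ->
  Delta2 phi ->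
  exists2 L, 0 < L & forall x y : R, phi `|x + y| <= L * (phi `|x| + phi `|y|).
Proof.
move=> phi_nd phi0 [L L0 phi2]; exists L => // x y.
wlog xy : x y / `|x| <= `|y|.
  by move=> h; case: (leP `|x| `|y|) => [/h//|/ltW/h]; rewrite addrC [X in L * X]addrC.
have phi_ge0 z : 0 <= phi `|z| by rewrite -phi0; exact: phi_nd.
apply: (@le_trans _ _ (phi (2 * `|y|))).
  apply: phi_nd => //; apply: le_trans (ler_normD _ _) _; lra.
by apply: le_trans (phi2 _ _) _ => //; rewrite ler_wpM2l ?(ltW L0)// lerDr.
Qed.

(** The majorant is [L * (phi |f| + phi C)], where [C] bounds [|Q|] on [Omega]; the constant is
    integrable because [Omega] has finite measure. *)
Lemma integrable_sub_peval (R : realType) (n : nat) (Omega : set (Rn R n))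
    (phi : R -> R) (f : Rn R n -> R) (Q : mpoly.mpoly n R) :
  measurable Omega -> bounded_Rn Omega -> class_Phi phi -> Lphi Omega phi f ->
  (lebesgue_n R n).-integrable Omega (fun x => (phi `|f x - peval Q x|)%:E).
Proof.
move=> mO bO [[psi [psi_nd psi0 _ _ _] phiE] D2] [mf flty].
have phi_nd := primitive_nd psi_nd psi0 phiE.
have phi_ge0 := primitive_ge0 psi_nd psi0 phiE.
have [L L0 phiD] := Delta2_norm_add phi_nd (primitive0 phiE) D2.
have [C QC] := peval_bounded Q bO.
have mphi := measurable_primitive_norm psi_nd psi0 phiE.
have mQ : measurable_fun Omega (peval Q).
  by apply: measurable_funTS; exact: measurable_peval.
have iphi : (lebesgue_n R n).-integrable Omega (fun x => (phi `|f x|)%:E).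
  apply/integrableP; split.
    by apply/measurable_EFinP; exact: measurableT_comp mphi mf.
  under eq_integral do rewrite gee0_abs ?lee_fin ?phi_ge0//.
  exact: flty.
have ic : (lebesgue_n R n).-integrable Omega (fun x => (phi C)%:E).
  apply: measurable_bounded_integrable => //.
    exact: lebesgue_n_bounded_lty.
  by exists `|phi C|; split; [exact: num_real|move=> M + r _; exact: ltW].
apply: le_integrable (integrableZl mO L (integrableD mO iphi ic)) => //.
  apply/measurable_EFinP; apply: measurableT_comp mphi _.
  exact: measurable_funB.
move=> x Ox /=; have C0 : 0 <= C by rewrite (le_trans _ (QC x Ox)).
rewrite lee_fin ger0_norm ?phi_ge0// [leRHS]ger0_norm; last first.
  by rewrite mulr_ge0 ?(ltW L0)// addr_ge0 ?phi_ge0.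
apply: le_trans (phiD _ _) _; rewrite ler_wpM2l ?(ltW L0)// lerD2l normrN.
exact/phi_nd/QC.
Qed.

(** * Minimality as a variational inequality *)

Local Open Scope ereal_scope.

Theorem theorem2p2 (R : realType) (n m : nat) (Omega : set (Rn R n))
    (mOmega : measurable Omega) (bOmega : bounded_Rn Omega)
    (phi : R -> R) (Phi_phi : class_Phi phi)
    (f : Rn R n -> R) (Lf : Lphi Omega phi f)
    (P : mpoly.mpoly n R) (PiP : Pi m P) :
  mu_phi Omega phi m f P <->
  forall Q : mpoly.mpoly n R, Pi m Q ->
    \int[lebesgue_n R n]_(x in Omega `&` [set x | (f x > peval P x)%R]
                                     `&` [set x | (peval Q x > 0)%R])
       (psi_minus phi `|f x - peval P x| * peval Q x)%:E
  + \int[lebesgue_n R n]_(x in Omega `&` [set x | (f x > peval P x)%R]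
                                     `&` [set x | (peval Q x < 0)%R])
       (psi_plus phi `|f x - peval P x| * peval Q x)%:E
  <=
    \int[lebesgue_n R n]_(x in Omega `&` [set x | (f x < peval P x)%R]
                                     `&` [set x | (peval Q x < 0)%R])
       (psi_minus phi `|f x - peval P x| * peval Q x)%:E
  + \int[lebesgue_n R n]_(x in Omega `&` [set x | (f x < peval P x)%R]
                                     `&` [set x | (peval Q x > 0)%R])
       (psi_plus phi `|f x - peval P x| * peval Q x)%:E.
Proof.
have [[psi [psi_nd psi0 _ psi_cvg0 _] phiE] _] := Phi_phi.
have mf : measurable_fun Omega f by case: Lf.
have mp Q : measurable_fun Omega (peval Q).
  by apply: measurable_funTS; exact: measurable_peval.
have subE := primitive_subgradient psi_nd psi0 phiE.
have iE Q := integrable_sub_peval Q mOmega bOmega Phi_phi Lf.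
pose E (x : R) := phi `|x|%R.
pose a x := (f x - peval P x)%R.
have ma : measurable_fun Omega a by exact: measurable_funB.
(* [f - P - c Q] is again [f] minus a polynomial. *)
have iB c Q : (lebesgue_n R n).-integrable Omega
    (fun x => (E (a x - c * peval Q x)%R)%:E).
  have := iE (P + c *: Q)%R; congr (_.-integrable _ _); apply/funext => x.
  by rewrite pevalD pevalZ /E /a opprD addrA.
have iB1 Q : (lebesgue_n R n).-integrable Omega
    (fun x => (E (a x - peval Q x)%R)%:E).
  by have := iB 1%R Q; under eq_fun do rewrite mul1r.
have iD1 Q : (lebesgue_n R n).-integrable Omega
    (fun x => (E (a x + peval Q x)%R)%:E).
  by have := iB (-1)%R Q; under eq_fun do rewrite mulN1r opprK.
have gtE : [set x | (f x > peval P x)%R] = [set x | (0 < a x)%R].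
  by apply/funext => x; rewrite /= /a subr_gt0.
have ltE : [set x | (f x < peval P x)%R] = [set x | (a x < 0)%R].
  by apply/funext => x; rewrite /= /a subr_lt0.
rewrite gtE ltE.
have {gtE ltE} keyE Q := integral_dirder_ge0 psi_nd psi0 psi_cvg0 phiE mOmega
  ma (mp Q) (iB1 Q) (iD1 Q).
suff : mu_phi Omega phi m f P <-> forall Q, Pi m Q ->
    0 <= \int[lebesgue_n R n]_(x in Omega) (dirder E (a x) (peval Q x))%:E.
  move=> ->; split=> h Q hQ; first by rewrite -keyE; exact: h.
  by rewrite keyE; exact: h.
split=> [[_ Pmin] Q PiQ|dir].
(* Necessity: [P + t Q] competes with [P], so each integrated quotient is nonnegative, and so is the
   limit. *)
- apply: (@cvge_ge _ _ _ _ _ _ _ _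
    (integral_dquot_cvg psi_nd psi0 phiE mOmega ma (mp Q) (iB1 Q) (iD1 Q))).
  apply: nearW => k; set t := (k.+1%:R^-1 : R)%R.
  have t0 : (0 < t)%R by rewrite invr_gt0.
  have i0 : (lebesgue_n R n).-integrable Omega (fun x => (E (a x))%:E) := iE P.
  rewrite (_ : \int[_]_(x in _) _ = \int[lebesgue_n R n]_(x in Omega)
      ((t^-1)%:E * ((E (a x - t * peval Q x)%R)%:E - (E (a x))%:E))); last first.
    by apply: eq_integral => x _; rewrite -EFinB -EFinM mulrC.
  rewrite integralZl//; last exact: integrableB.
  rewrite integralB//.
  apply: mule_ge0; first by rewrite lee_fin invr_ge0 ltW.
  rewrite sube_ge0; last by rewrite integrable_fin_num.
  have -> : \int[lebesgue_n R n]_(x in Omega) (E (a x))%:E =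
    modular Omega phi (fun x => f x - peval P x)%R by [].
  rewrite Pmin; apply: ereal_inf_lbound; exists (P + t *: Q)%R.
    by apply: PiD => //; exact: PiZ.
  by apply: eq_integral => x _; rewrite pevalD pevalZ /E /a opprD addrA.
- split=> //; apply/le_anti/andP; split; last first.
    by apply: ereal_inf_lbound; exists P.
  apply/ereal_infP => _ [Q PiQ <-].
  (* Sufficiency: in the direction [H = Q - P], a full step from [f - P] arrives at [f - Q]. *)
  pose H := (Q + (-1) *: P)%R.
  have PiH : Pi m H by apply: PiD => //; exact: PiZ.
  have aH x : (a x - peval H x = f x - peval Q x)%R.
    by rewrite pevalD pevalZ /a; ring.
  have i0 : (lebesgue_n R n).-integrable Omega (fun x => (E (a x))%:E) := iE P.
  rewrite -sube_ge0; last by rewrite integrable_fin_num//; exact: iE.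
  have -> : modular Omega phi (fun x => f x - peval Q x)%R =
      \int[lebesgue_n R n]_(x in Omega) (E (a x - peval H x)%R)%:E.
    by apply: eq_integral => x _; rewrite aH.
  rewrite -integralB//.
  (* The pointwise bound [dirder_le] is integrated. *)
  apply: le_trans (dir H PiH) _; apply: le_integral => //.
  + exact: (integrable_dirder psi_nd psi0 phiE mOmega ma (mp H)
      (iB1 H) (iD1 H)).
  + exact: integrableB.
  + by move=> x _; rewrite -EFinB lee_fin; exact: dirder_le subE _ _.
Qed.
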